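(* Let $m\ge n$, let $a<b$ be real numbers, and let $F:[a,b]\rightarrow M_{m\times n}(\mathbb{C})$ be a function whose entries are analytic functions on $[a,b]$. Let $\mathcal{W}$ be the set of $x\in[a,b]$ for which $F(x)$ has repeated singular values. Then either $\mathcal{W}=[a,b]$ or $\mathcal{W}$ is finite.
   Context: $M_{m\times n}(\mathbb{C})$ denotes the set of $m\times n$ complex matrices; throughout $m\ge n$. The singular values of $A\in M_{m\times n}(\mathbb{C})$ are the $n$ nonnegative square roots of the eigenvalues of $A^{\ast}A$, counted with multiplicity; repeated means two of them coincide. A complex-valued function is analytic on $[a,b]$ if it is the restriction of a function defined on an open interval containing $[a,b]$ which around each point is given by a convergent power series. *)

(* Defs.v *)
From HB Require Import structures.
From mathcomp Require Import all_boot all_order all_algebra.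
From mathcomp Require Import all_classical all_reals all_analysis.
From mathcomp Require Import complex.

Set Implicit Arguments.
Unset Strict Implicit.
Unset Printing Implicit Defensive.

Import Order.TTheory GRing.Theory Num.Theory.
Import numFieldNormedType.Exports.
Local Open Scope classical_set_scope.
Local Open Scope ring_scope.

(* A function f : R -> R[i] (complex-valued function of a real variable) is
   given around x0, on the open interval ]x0 - r, x0 + r[, by the convergent
   power series sum_k c_k (y - x0)^k with complex coefficients c_k.
   Convergence in C = R^2 is convergence of the real and imaginary parts;
   since (y - x0) is real, Re (c_k (y-x0)^k) = Re c_k * (y-x0)^k, and
   likewise for Im. *)
Definition power_series_at (R : realType) (f : R -> R[i]) (x0 : R) : Prop :=
  exists (c : nat -> R[i]) (r : R), 0 < r /\
    forall y : R, `|y - x0| < r ->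
      ((fun N : nat => \sum_(k < N) complex.Re (c k) * (y - x0) ^+ k)
          @ \oo --> complex.Re (f y)) /\
      ((fun N : nat => \sum_(k < N) complex.Im (c k) * (y - x0) ^+ k)
          @ \oo --> complex.Im (f y)).

Definition analytic_on_closed (R : realType) (a b : R) (f : R -> R[i]) : Prop :=
  exists (g : R -> R[i]) (c d : R),
    c < a /\ b < d /\
    (forall x, a <= x <= b -> g x = f x) /\
    (forall x0, c < x0 < d -> power_series_at g x0).

Definition adjoint (R : realType) (m n : nat) (A : 'M[R[i]]_(m, n)) :
  'M[R[i]]_(n, m) := (map_mx Num.conj A)^T.

Definition sv_mult (R : realType) (m n : nat) (A : 'M[R[i]]_(m, n)) (s : R) : nat :=
  mup ((s ^+ 2)%:C)%C (char_poly (adjoint A *m A)).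

Definition repeated_singular_values (R : realType) (m n : nat)
  (A : 'M[R[i]]_(m, n)) : Prop :=
  exists s : R, 0 <= s /\ (1 < sv_mult A s)%N.

(* Main.v *)
(** Writing [H x = F(x)^* F(x)] and [chi x] for its characteristic polynomial,
[F x] has a repeated singular value iff [chi x] has a multiple root (all roots
being nonnegative reals), iff [D x = det ((chi x)' (H x))] vanishes: a common
root of [chi] and [chi'] gives an eigenvector of [H] killed by [chi' (H)], and
otherwise Bezout and Cayley-Hamilton invert [chi' (H)].  [D] is obtained by ring
operations from the entries of [F] and their conjugates, so [|D|^2] is real
analytic; each of its zeros is isolated or interior to the zero set, and the
connected compact interval [[a, b]] leaves only the two alternatives. *)
Require Import Defs.
From HB Require Import structures.
From mathcomp Require Import all_boot all_order all_algebra.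
From mathcomp Require Import all_classical all_reals all_analysis.
From mathcomp Require Import complex ring lra.
Set Implicit Arguments.
Unset Strict Implicit.
Unset Printing Implicit Defensive.

Import Order.TTheory GRing.Theory Num.Theory.
Import numFieldNormedType.Exports.
Local Open Scope classical_set_scope.
Local Open Scope ring_scope.

(** * Multiple roots of characteristic polynomials *)

Lemma mup_gt1_deriv (F : fieldType) (p : {poly F}) (z : F) : p != 0 ->
  (1 < mup z p)%N = root p z && root p^`() z.
Proof.
move=> p0; rewrite (mup_geq z 2 p0); apply/idP/andP.
  case/dvdpP => q ->; split.
    by rewrite /root expr2 !hornerM hornerXsubC subrr !mulr0.
  rewrite /root expr2 !derivM derivXsubC.
  by rewrite !(hornerD, hornerM, hornerN, hornerX, hornerC) subrr !(mul0r, mulr0, addr0).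
case=> /factor_theorem [q ->].
rewrite /root derivM derivXsubC mulr1 !hornerE subrr mulr0 add0r.
move=> /factor_theorem [u ->].
by rewrite -mulrA -expr2 dvdp_mulIr.
Qed.

Lemma horner_mx_eigenvector (F : fieldType) n (A : 'M[F]_n.+1) (v : 'rV_n.+1)
  (z : F) (p : {poly F}) :
  v *m A = z *: v -> v *m horner_mx A p = p.[z] *: v.
Proof.
move=> vA; elim/poly_ind: p => [|p c IH].
  by rewrite rmorph0 mulmx0 horner0 scale0r.
rewrite rmorphD rmorphM /= horner_mx_X horner_mx_C mulmxDr.
rewrite -[horner_mx A p * A]/(horner_mx A p *m A) mulmxA IH -scalemxAl vA.
by rewrite mul_mx_scalar scalerA -scalerDl !hornerE.
Qed.

Lemma mup_char_poly_gt1 (F : closedFieldType) n (A : 'M[F]_n.+1) :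
  (exists z, (1 < mup z (char_poly A))%N) <->
  \det (horner_mx A (char_poly A)^`()) = 0.
Proof.
have chi0 : char_poly A != 0 by rewrite monic_neq0 ?char_poly_monic.
split=> [[z]|det0].
  rewrite mup_gt1_deriv // -eigenvalue_root_char => /andP[/eigenvalueP[v vA v0]].
  move=> /rootP rz; apply/eqP/det0P; exists v => //.
  by rewrite (horner_mx_eigenvector _ vA) rz scale0r.
have [/Bezout_eq1_coprimepP[[u w] /= uw]|ncop] :=
    boolP (coprimep (char_poly A) (char_poly A)^`()).
  have : horner_mx A (u * char_poly A + w * (char_poly A)^`()) = 1.
    by rewrite uw rmorph1.
  rewrite rmorphD !rmorphM /= Cayley_Hamilton mulr0 add0r => /(congr1 determinant).
  by rewrite det_mulmx det0 mulr0 det1 => /esym/eqP; rewrite oner_eq0.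
(* Over an algebraically closed field a gcd of size other than [1] has a root, common to both
   polynomials. *)
have /closed_rootP[z] : size (gcdp (char_poly A) (char_poly A)^`()) != 1%N by [].
by rewrite root_gcd => rz; exists z; rewrite mup_gt1_deriv.
Qed.

(** * Positivity of Gram matrices and singular values *)

Lemma rV_mul_adjoint (R : realType) n (v : 'rV[R[i]]_n) :
  (v *m adjoint v) 0 0 = \sum_j `|v 0 j| ^+ 2.
Proof. by rewrite mxE; apply: eq_bigr => j _; rewrite !mxE normCK. Qed.

Lemma rV_mul_adjoint_ge0 (R : realType) n (v : 'rV[R[i]]_n) :
  0 <= (v *m adjoint v) 0 0.
Proof. by rewrite rV_mul_adjoint sumr_ge0 // => j _; rewrite exprn_ge0. Qed.

Lemma rV_mul_adjoint_gt0 (R : realType) n (v : 'rV[R[i]]_n) : v != 0 ->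
  0 < (v *m adjoint v) 0 0.
Proof.
move=> v0; rewrite lt_neqAle rV_mul_adjoint_ge0 andbT eq_sym rV_mul_adjoint.
apply: contra v0 => /eqP s0; apply/eqP/rowP => j; rewrite mxE.
have /psumr_eq0P/(_ s0 j isT)/eqP : forall i : 'I_n, true -> 0 <= `|v 0 i| ^+ 2.
  by move=> i _; rewrite exprn_ge0.
by rewrite expf_eq0 normr_eq0 => /andP[_ /eqP].
Qed.

Lemma adjointM (R : realType) m n p (A : 'M[R[i]]_(m, n)) (B : 'M[R[i]]_(n, p)) :
  adjoint (A *m B) = adjoint B *m adjoint A.
Proof. by rewrite /adjoint map_mxM trmx_mul. Qed.

Lemma adjointK (R : realType) m n (A : 'M[R[i]]_(m, n)) : adjoint (adjoint A) = A.
Proof. by apply/matrixP => i j; rewrite !mxE conjCK. Qed.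

(** A row eigenvector [v] satisfies [z * |v|^2 = |v *m adjoint A|^2], and [|v|^2 > 0]. *)
Lemma eigenvalue_gram_ge0 (R : realType) m n (A : 'M[R[i]]_(m, n)) (z : R[i]) :
  eigenvalue (adjoint A *m A) z -> 0 <= z.
Proof.
case/eigenvalueP => v vA v0.
have := rV_mul_adjoint_ge0 (v *m adjoint A).
rewrite adjointM adjointK mulmxA -(mulmxA v) vA -scalemxAl mxE.
by rewrite pmulr_lge0 // rV_mul_adjoint_gt0.
Qed.

(** Singular values only see roots that are squares of nonnegative reals; no multiple root is lost,
    since every root is a nonnegative real. *)
Lemma repeated_singular_valuesP (R : realType) m n (A : 'M[R[i]]_(m, n)) :
  repeated_singular_values A <->
  exists z, (1 < mup z (char_poly (adjoint A *m A)))%N.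
Proof.
split=> [[s [s0 ms]]|[z mz]]; first by exists ((s ^+ 2)%:C)%C.
have chi0 : char_poly (adjoint A *m A) != 0.
  by rewrite monic_neq0 ?char_poly_monic.
have z0 : 0 <= z.
  apply: (@eigenvalue_gram_ge0 _ _ _ A); rewrite eigenvalue_root_char.
  by move: mz; rewrite mup_gt1_deriv // => /andP[].
exists (Num.sqrt (complex.Re z)); split; first exact: sqrtr_ge0.
have Rz0 : 0 <= complex.Re z by move: z0; rewrite lecE => /andP[].
have Ez : ((Num.sqrt (complex.Re z) ^+ 2)%:C)%C = z.
  by rewrite sqr_sqrtr // (RRe_real (ger0_real z0)).
by rewrite /sv_mult Ez.
Qed.

(** * Rings of functions and determinants *)

Section FunctionSubring.
Variables (T : Type) (S : comNzRingType) (P : (T -> S) -> Prop).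

(** The constant [-1] brings differences and signs under sums and products. *)
Definition function_subring :=
  [/\ forall c, P (fun=> c),
      forall f g, P f -> P g -> P (fun x => f x + g x) &
      forall f g, P f -> P g -> P (fun x => f x * g x)].

Hypothesis subP : function_subring.

Lemma function_subring_sum (I : Type) (r : seq I) (Q : pred I) (F : I -> T -> S) :
  (forall i, P (F i)) -> P (fun x => \sum_(i <- r | Q i) F i x).
Proof.
case: subP => Pc PD _ PF; elim: r => [|i r IH].
  by rewrite (_ : (fun=> _) = fun=> 0); [exact: Pc|apply/funext => x; rewrite big_nil].
under eq_fun do rewrite big_cons.
by case: (Q i) => //; exact: PD.
Qed.

Lemma function_subring_prod (I : Type) (r : seq I) (Q : pred I) (F : I -> T -> S) :
  (forall i, P (F i)) -> P (fun x => \prod_(i <- r | Q i) F i x).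
Proof.
case: subP => Pc _ PM PF; elim: r => [|i r IH].
  by rewrite (_ : (fun=> _) = fun=> 1); [exact: Pc|apply/funext => x; rewrite big_nil].
under eq_fun do rewrite big_cons.
by case: (Q i) => //; exact: PM.
Qed.

(** Leibniz expansion: each summand is a constant sign times a product of entries. *)
Lemma function_subring_det n (A : T -> 'M[S]_n) :
  (forall i j, P (fun x => A x i j)) -> P (fun x => \det (A x)).
Proof.
case: subP => Pc _ PM PA; apply: function_subring_sum => s.
by apply: PM => //; exact: function_subring_prod.
Qed.

Lemma function_subring_mulmx m n p (A : T -> 'M[S]_(m, n)) (B : T -> 'M[S]_(n, p)) :
  (forall i j, P (fun x => A x i j)) -> (forall i j, P (fun x => B x i j)) ->
  forall i j, P (fun x => (A x *m B x) i j).
Proof.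
case: subP => _ _ PM PA PB i j; under eq_fun do rewrite mxE.
by apply: function_subring_sum => k; exact: PM.
Qed.

End FunctionSubring.

Section FunctionSubringCharPoly.
Variables (T : Type) (S : comNzRingType) (P : (T -> S) -> Prop).
Hypothesis subP : function_subring P.

(** Makes the determinant lemma applicable over [{poly S}], where [char_poly] is a determinant. *)
Lemma function_subring_coef :
  function_subring (fun p : T -> {poly S} => forall k, P (fun x => (p x)`_k)).
Proof.
case: (subP) => Pc PD PM; split=> [c k|f g Pf Pg k|f g Pf Pg k].
- exact: Pc.
- under eq_fun do rewrite coefD.
  exact: PD.
- under eq_fun do rewrite coefM.
  by apply: (function_subring_sum subP) => i; exact: PM.
Qed.

Lemma function_subring_char_poly n (A : T -> 'M[S]_n) :
  (forall i j, P (fun x => A x i j)) ->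
  forall k, P (fun x => (char_poly (A x))`_k).
Proof.
case: (subP) => Pc PD PM PA.
apply: (function_subring_det function_subring_coef) => i j k.
(* Coefficient [k] of an entry of the characteristic matrix is a constant plus [-1] times an entry
   of [A] if [k = 0], and plus [-1] times [0] otherwise. *)
under eq_fun do rewrite !mxE coefB coefC -mulN1r.
apply: PD; first exact: Pc.
by case: (k == 0)%N; apply: PM => //; exact: Pc.
Qed.

(** The uniform bound [d] turns evaluation into a sum whose number of terms does not depend on
    [x]. *)
Lemma function_subring_horner_mx n d (A : T -> 'M[S]_n.+1) (p : T -> {poly S}) :
  (forall x, (size (p x) <= d)%N) ->
  (forall i j, P (fun x => A x i j)) -> (forall k, P (fun x => (p x)`_k)) ->
  forall i j, P (fun x => horner_mx (A x) (p x) i j).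
Proof.
case: (subP) => Pc PD PM sp PA Pp i j.
have PX k : forall i j, P (fun x => (A x ^+ k) i j).
  elim: k => [|k IH] i' j'; first exact: Pc.
  under eq_fun do rewrite exprS.
  exact: (function_subring_mulmx subP).
have E x : horner_mx (A x) (p x) = \sum_(k < d) (p x)`_k *: A x ^+ k.
  rewrite {1}(_ : p x = \sum_(k < d) (p x)`_k *: 'X^k); last first.
    apply/polyP => k; rewrite -poly_def coef_poly; case: ltnP => // dk.
    by rewrite nth_default // (leq_trans (sp x)).
  rewrite rmorph_sum; apply: eq_bigr => k _.
  by rewrite /= horner_mxZ rmorphXn /= horner_mx_X.
under eq_fun do rewrite E summxE.
apply: (function_subring_sum subP) => k; under eq_fun do rewrite mxE.
exact: PM.
Qed.

End FunctionSubringCharPoly.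

(** * Real analyticity and isolated zeros *)

Section Taylor.
Variable R : realType.
Implicit Types (f g : R -> R) (h K M : R) (N : nat).

(* Real analyticity at [x0], quantified through the Taylor remainders so that no
   limit is involved. *)
Definition taylor_at f x0 := exists (c : nat -> R) K M, 0 <= K /\ 0 < M /\
  forall N h, M * `|h| <= 1 ->
    `|f (x0 + h) - \sum_(k < N) c k * h ^+ k| <= K * (M * `|h|) ^+ N.

Lemma taylor_at_cst (a x0 : R) : taylor_at (fun=> a) x0.
Proof.
(* The bound [|a|] serves [N = 0], where the partial sum is empty; all later remainders vanish. *)
exists (fun k => if k is 0%N then a else 0), `|a|, 1; split; [|split] => //.
case=> [|N] h _; first by rewrite big_ord0 subr0 expr0 mulr1.
rewrite big_ord_recl big1 => [|k _]; last by rewrite mul0r.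
by rewrite expr0 mulr1 addr0 subrr normr0 mulr_ge0 // exprn_ge0 // mul1r.
Qed.

Lemma taylor_at_add f g x0 : taylor_at f x0 -> taylor_at g x0 ->
  taylor_at (fun x => f x + g x) x0.
Proof.
case=> [c [K [M [K0 [M0 Hf]]]]] [d [L [Q [L0 [Q0 Hg]]]]].
exists (fun k => c k + d k), (K + L), (M + Q).
split; first exact: addr_ge0.
split=> [|N h]; first exact: addr_gt0.
have h0 : 0 <= `|h| by [].
rewrite mulrDl => hMQ.
have Mh0 : 0 <= M * `|h| by rewrite mulr_ge0 // ltW.
have Qh0 : 0 <= Q * `|h| by rewrite mulr_ge0 // ltW.
have E : \sum_(k < N) (c k + d k) * h ^+ k =
    \sum_(k < N) c k * h ^+ k + \sum_(k < N) d k * h ^+ k.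
  by rewrite -big_split; apply: eq_bigr => k _; rewrite mulrDl.
rewrite E opprD addrACA (le_trans (ler_normD _ _)) // mulrDl lerD //.
  rewrite (le_trans (Hf N h _)) ?ler_wpM2l ?lerXn2r ?nnegrE //; lra.
rewrite (le_trans (Hg N h _)) ?ler_wpM2l ?lerXn2r ?nnegrE //; lra.
Qed.

(** Both sides sum [c i * d j * h ^+ (i + j)] over the triangle [i + j < N], by antidiagonals and by
    rows. *)
Lemma sum_cauchy_product (c d : nat -> R) h N :
  \sum_(k < N) (\sum_(i < k.+1) c i * d (k - i)%N) * h ^+ k =
  \sum_(i < N) c i * h ^+ i * \sum_(j < N - i) d j * h ^+ j.
Proof.
elim: N => [|N IH]; first by rewrite !big_ord0.
rewrite big_ord_recr /= IH [RHS]big_ord_recr [in RHS]/=.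
rewrite subSnn big_ord1 expr0 mulr1 [X in _ + X * _]big_ord_recr /= subnn.
rewrite mulrDl addrA mulr_suml; congr (_ + _); last by ring.
rewrite -big_split; apply: eq_bigr => i _ /=.
rewrite subSn ?(ltnW (ltn_ord i)) // big_ord_recr /= mulrDr; congr (_ + _).
have -> : h ^+ N = h ^+ i * h ^+ (N - i) by rewrite -exprD subnKC // ltnW.
ring.
Qed.

(* The remainder of the product splits as
   [sum_(i < N) c_i h^i (g - sum_(j < N - i) d_j h^j) + (f - sum_(i < N) c_i h^i) g];
   each of the [N + 1] terms is [O((M h)^N)], and [N + 1 <= 2^N]. *)
Lemma taylor_at_mul f g x0 : taylor_at f x0 -> taylor_at g x0 ->
  taylor_at (fun x => f x * g x) x0.
Proof.
case=> [c [K [M [K0 [M0 Hf]]]]] [d [L [Q [L0 [Q0 Hg]]]]].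
(* Cauchy estimate: at [h = M^-1] two consecutive remainders are at most [K], and they differ by
   [c i * M^-1 ^+ i]. *)
have cK i : `|c i| <= (K + K) * M ^+ i.
  have Mi : M * `|M^-1| = 1 by rewrite gtr0_norm ?invr_gt0 // divff ?gt_eqF.
  have := Hf i M^-1; have := Hf i.+1 M^-1.
  rewrite Mi !expr1n big_ord_recr /= mulr1 lexx => /(_ isT) H1 /(_ isT) H2.
  rewrite -ler_pdivrMr ?exprn_gt0 //.
  have -> : `|c i| / M ^+ i = `|c i * M^-1 ^+ i|.
    by rewrite normrM exprVn (@ger0_norm _ (M ^+ i)^-1) // invr_ge0 exprn_ge0 ?ltW.
  move: H1 H2; set s := \sum_(_ < _) _; set t := c i * _ => H1 H2.
  have -> : t = (f (x0 + M^-1) - s) - (f (x0 + M^-1) - (s + t)) by ring.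
  by rewrite (le_trans (ler_normB _ _)) // lerD.
set B := M + Q; have B0 : 0 < B by rewrite addr_gt0.
exists (fun k => \sum_(i < k.+1) c i * d (k - i)%N), ((K + K) * L + K * L), (2 * B).
split; first by rewrite addr_ge0 ?mulr_ge0 ?addr_ge0.
split=> [|N h hB]; first by rewrite mulr_gt0.
have Bh0 : 0 <= B * `|h| by rewrite mulr_ge0 // ltW.
have Mh0 : 0 <= M * `|h| by rewrite mulr_ge0 // ltW.
have Qh0 : 0 <= Q * `|h| by rewrite mulr_ge0 // ltW.
have MQB : M * `|h| + Q * `|h| = B * `|h| by rewrite -mulrDl.
have Mh1 : M * `|h| <= 1 by rewrite -mulrA in hB; lra.
have Qh1 : Q * `|h| <= 1 by rewrite -mulrA in hB; lra.
have MB n : (M * `|h|) ^+ n <= (B * `|h|) ^+ n by rewrite lerXn2r ?nnegrE //; lra.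
have QB n : (Q * `|h|) ^+ n <= (B * `|h|) ^+ n by rewrite lerXn2r ?nnegrE //; lra.
rewrite sum_cauchy_product.
set u := f _; set v := g _.
have -> : u * v - \sum_(i < N) c i * h ^+ i * \sum_(j < N - i) d j * h ^+ j =
    \sum_(i < N) c i * h ^+ i * (v - \sum_(j < N - i) d j * h ^+ j) +
    (u - \sum_(i < N) c i * h ^+ i) * v.
  under [X in _ = X + _]eq_bigr do rewrite mulrBr.
  by rewrite sumrB -mulr_suml; ring.
(* The remainder for [N = 0] is the function itself. *)
have vL : `|v| <= L by have := Hg 0%N h Qh1; rewrite big_ord0 subr0 expr0 mulr1.
have bound1 : `|\sum_(i < N) c i * h ^+ i * (v - \sum_(j < N - i) d j * h ^+ j)| <=
    N%:R * ((K + K) * L * (B * `|h|) ^+ N).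
  rewrite mulr_natl -[X in _ *+ X]card_ord -sumr_const.
  rewrite (le_trans (ler_norm_sum _ _ _)) //; apply: ler_sum => i _.
  have -> : (B * `|h|) ^+ N = (B * `|h|) ^+ i * (B * `|h|) ^+ (N - i).
    by rewrite -exprD subnKC // ltnW.
  rewrite mulrACA normrM.
  apply: ler_pM => //; last first.
    by rewrite (le_trans (Hg _ _ Qh1)) // ler_wpM2l.
  rewrite normrM normrX (le_trans (ler_wpM2r _ (cK i))) ?exprn_ge0 //.
  by rewrite -mulrA -exprMn ler_wpM2l ?addr_ge0.
have bound2 : `|(u - \sum_(i < N) c i * h ^+ i) * v| <= K * L * (B * `|h|) ^+ N.
  rewrite normrM mulrAC; apply: ler_pM => //.
  by rewrite (le_trans (Hf _ _ Mh1)) // ler_wpM2l.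
rewrite (le_trans (ler_normD _ _)) // (le_trans (lerD bound1 bound2)) //.
have -> : (2 * B * `|h|) ^+ N = 2 ^+ N * (B * `|h|) ^+ N.
  by rewrite -mulrA exprMn.
set X := (B * `|h|) ^+ N; have X0 : 0 <= X by rewrite exprn_ge0.
have N2 : N%:R <= 2 ^+ N :> R by rewrite -natrX ler_nat ltnW // ltn_expl.
have N1 : 1 <= 2 ^+ N :> R by rewrite exprn_ege1 // ler1n.
rewrite [leRHS](_ : _ = 2 ^+ N * ((K + K) * L * X) + 2 ^+ N * (K * L * X)); last by ring.
by rewrite lerD ?ler_wpM2r ?ler_peMl ?mulr_ge0 ?addr_ge0.
Qed.

(** Near [x0] the first nonzero Taylor term dominates the next remainder. If there is none, [f] is
    bounded by [K * (M * |h|) ^+ N] for every [N], hence vanishes near [x0]. *)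
Lemma taylor_at_isolated_zero f x0 : taylor_at f x0 ->
  (exists2 r, 0 < r & forall x, `|x - x0| < r -> f x = 0) \/
  (exists2 r, 0 < r & forall x, `|x - x0| < r -> x != x0 -> f x != 0).
Proof.
case=> [c [K [M [K0 [M0 Hf]]]]].
have [[k ck]|/forallNP c0] := pselect (exists k, c k != 0).
  right; case: (ex_minnP (ex_intro (fun k => c k != 0) k ck)) => {ck}k ck kmin.
  (* The [+ 1] keeps [d] positive even when [K = 0]; the radius [|c k| / d] yields
     [K * M ^+ k.+1 * |h| < |c k|]. *)
  pose d := K * M ^+ k.+1 + 1.
  have d0 : 0 < d by rewrite ltr_wpDl // mulr_ge0 // exprn_ge0 // ltW.
  exists (Num.min M^-1 (`|c k| / d)).
    by rewrite lt_min invr_gt0 M0 divr_gt0 // normr_gt0.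
  move=> x; rewrite lt_min => /andP[xM xc] xx0.
  have h0 : 0 < `|x - x0| by rewrite normr_gt0 subr_eq0.
  have := Hf k.+1 (x - x0); rewrite subrKC big_ord_recr /= big1 ?add0r; last first.
    move=> i _; have [->|/kmin] := eqVneq (c i) 0; first by rewrite mul0r.
    by rewrite leqNgt ltn_ord.
  have Mh : M * `|x - x0| <= 1 by rewrite -ler_pdivlMl // mulr1 ltW.
  move=> /(_ Mh); apply: contraTneq => ->; rewrite sub0r normrN -ltNge.
  rewrite normrM normrX exprMn [X in _ * (_ * X)]exprS !mulrA.
  rewrite ltr_pM2r ?exprn_gt0 //.
  move: xc; rewrite ltr_pdivlMr // mulrC; apply: le_lt_trans.
  by rewrite ler_pM2r // lerDl.
(* Here [M * |h| <= 1/2], so the remainder bounds tend to [0] geometrically. *)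
left; exists (2 * M)^-1; first by rewrite invr_gt0 mulr_gt0.
move=> x xM; apply/eqP; rewrite -normr_le0.
apply/ler_addgt0Pl => e e0; rewrite addr0.
have Mh : M * `|x - x0| <= 2^-1.
  by rewrite -ler_pdivlMl // ltW // (lt_le_trans xM) // invfM mulrC.
have [N KN] : exists N, K * 2^-1 ^+ N < e.
  have [N] : exists N, K / e < 2 ^+ N.
    have := archi_boundP (divr_ge0 K0 (ltW e0)).
    set N := Num.bound _ => KN; exists N; apply: (lt_trans KN).
    by rewrite -natrX ltr_nat ltn_expl.
  rewrite ltr_pdivrMr // => KN; exists N.
  by rewrite exprVn ltr_pdivrMr ?exprn_gt0 // mulrC.
have := Hf N (x - x0); rewrite subrKC big1 ?subr0 => [H|k _]; last first.
  by have /negP/negbNE/eqP -> := c0 k; rewrite mul0r.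
apply: le_trans (ltW KN); rewrite (le_trans (H _)) //.
  by rewrite (le_trans Mh) // invf_le1 ?ler1n.
by rewrite ler_wpM2l // lerXn2r ?nnegrE // mulr_ge0 // ltW.
Qed.

(** Convergence at distance [p = r / 2] bounds [|c k| * p ^+ k] by some [B], so for [|h| <= p / 2]
    the tails are dominated by a geometric series of ratio [|h| / p <= 1/2]. *)
Lemma cvg_power_series_taylor_at f (c : nat -> R) (x0 r : R) : 0 < r ->
  (forall y : R, `|y - x0| < r ->
     (fun N : nat => \sum_(k < N) c k * (y - x0) ^+ k) @ \oo --> f y) ->
  taylor_at f x0.
Proof.
move=> r0 cf; pose p := r / 2.
have p0 : 0 < p by rewrite divr_gt0.
have [B B0 cB] : exists2 B, 0 <= B & forall k, `|c k| * p ^+ k <= B.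
  have /cf cp : `|x0 + p - x0| < r by rewrite addrC addKr gtr0_norm // /p; lra.
  have /cvg_seq_bounded[B [_ HB]] : cvgn (fun N => \sum_(k < N) c k * (x0 + p - x0) ^+ k).
    by apply/cvg_ex; exists (f (x0 + p)).
  have {}HB := HB (`|B| + 1) (ltr_pwDr ltr01 (ler_norm B)).
  exists ((`|B| + 1) + (`|B| + 1)); first by rewrite !addr_ge0.
  move=> k; have := HB k I; have := HB k.+1 I; rewrite /= big_ord_recr /=.
  rewrite [x0 + p]addrC addrK; set s := \sum_(_ < _) _ => H1 H2.
  have -> : `|c k| * p ^+ k = `|(s + c k * p ^+ k) - s|.
    by rewrite addrAC subrr add0r normrM (@ger0_norm _ (p ^+ k)) // exprn_ge0 ?ltW.
  by rewrite (le_trans (ler_normB _ _)) // lerD.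
exists c, (2 * B), (2 / p); split; first by rewrite mulr_ge0.
split=> [|N h]; first by rewrite divr_gt0.
set q := `|h| / p.
have -> : 2 / p * `|h| = 2 * q by rewrite /q; ring.
move=> q1; have q0 : 0 <= q by rewrite divr_ge0 // ltW.
have qN : q ^+ N <= (2 * q) ^+ N.
  by rewrite lerXn2r ?nnegrE ?(mulr_ge0 _ q0) // ler_peMl // ler1n.
apply: (@le_trans _ _ (2 * B * q ^+ N)); last by rewrite ler_wpM2l ?mulr_ge0.
have ck k : `|c k * h ^+ k| <= B * q ^+ k.
  rewrite normrM normrX -[`|h|](divfK (lt0r_neq0 p0)) -/q exprMn mulrCA mulrC.
  by rewrite ler_wpM2r ?exprn_ge0.
(* The subtracted [q ^+ (N + m)] makes the induction close: [q <= 1/2] gives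
   [q ^+ n <= 2 * (q ^+ n - q ^+ n.+1)]. *)
have tail m : `|\sum_(k < N + m) c k * h ^+ k - \sum_(k < N) c k * h ^+ k| <=
    2 * B * (q ^+ N - q ^+ (N + m)).
  elim: m => [|m IH]; first by rewrite addn0 !subrr normr0 mulr0.
  rewrite addnS big_ord_recr /= addrAC (le_trans (ler_normD _ _)) //.
  rewrite (le_trans (lerD IH (ck _))) // exprS.
  set X := q ^+ (N + m); have X0 : 0 <= B * X by rewrite mulr_ge0 // exprn_ge0.
  have : B * X * (2 * q) <= B * X by rewrite ler_piMr.
  lra.
have hE : x0 + h - x0 = h by ring.
have /cf cfh : `|x0 + h - x0| < r.
  by rewrite hE; move: q1; rewrite /q mulrA ler_pdivrMr // /p; lra.
rewrite hE in cfh.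
have : (fun n => `|\sum_(k < n) c k * h ^+ k - \sum_(k < N) c k * h ^+ k|) @ \oo -->
    `|f (x0 + h) - \sum_(k < N) c k * h ^+ k|.
  by apply: cvg_norm; apply: (cvgB cfh); apply: cvg_cst.
apply: (@closed_cvg _ _ _ _ _ (fun y => y <= 2 * B * q ^+ N)).
  exact: closed_le.
exists N => // n /= Nn; rewrite -(subnKC Nn) (le_trans (tail _)) //.
by rewrite ler_wpM2l ?mulr_ge0 // gerBl exprn_ge0.
Qed.

End Taylor.

(** * From local to global on a compact interval *)

Section IntervalDichotomy.
Variable R : realType.
Implicit Types (P : R -> R -> Prop) (s t : R).

(* A form of Cousin's lemma, proved through [sup {t | P a t}]. *)
Lemma interval_additive_property P (a b : R) : a <= b ->
  (forall s t u, s <= t -> t <= u -> P s t -> P t u -> P s u) ->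
  (forall x, a <= x <= b ->
    exists2 r, 0 < r & forall s t, s <= x <= t -> x - r < s -> t < x + r -> P s t) ->
  P a b.
Proof.
move=> ab Padd Ploc; pose E := [set t | a <= t <= b /\ P a t].
have Ea : E a.
  split; first by rewrite lexx.
  have [|r r0 H] := Ploc a; first by rewrite lexx.
  by apply: H; rewrite ?lexx //; lra.
have supE : has_sup E by split; [exists a|exists b => t [/andP[]]].
have aS : a <= sup E by apply: ub_le_sup => //; case: supE.
have Sb : sup E <= b by apply: ge_sup; [exists a|move=> t [/andP[]]].
have [|r r0 H] := Ploc (sup E); first by rewrite aS Sb.
have [e [/andP[ae eb] Pe] Se] := sup_adherent r0 supE.
have eS : e <= sup E by apply: ub_le_sup; [case: supE|split; [rewrite ae|]].
(* This point lies past the supremum unless capped by [b]. Joining [P a e] and [P e t] puts it in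
   [E], so the cap is reached and [t = b]. *)
pose t := Num.min b (sup E + r / 2).
have tb : t <= b by rewrite ge_min lexx.
have tr : t < sup E + r by rewrite gt_min; apply/orP; right; lra.
have St : sup E <= t by rewrite le_min Sb /=; lra.
have Pt : P a t.
  by apply: (Padd _ e) => //; [exact: le_trans St|apply: H => //; rewrite eS].
have : t <= sup E.
  by apply: ub_le_sup; [case: supE|split; rewrite // (le_trans aS)].
have [tE _|] := leP b (sup E + r / 2).
  by move: Pt; rewrite /t min_l.
by move=> bt; rewrite /t min_r ?(ltW bt) //; lra.
Qed.

Lemma zeros_all_or_finite (f : R -> R) (a b : R) : a <= b ->
  (forall x, a <= x <= b ->
    (exists2 r, 0 < r & forall y, `|y - x| < r -> f y = 0) \/
    (exists2 r, 0 < r & forall y, `|y - x| < r -> y != x -> f y != 0)) ->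
  (forall x, a <= x <= b -> f x = 0) \/ finite_set [set x | a <= x <= b /\ f x = 0].
Proof.
move=> ab floc.
pose flat x := exists2 r, 0 < r & forall y, `|y - x| < r -> f y = 0.
(* Either every point of [[s, t]] is flat, or none is and the zeros are finite in number. Adjacent
   intervals must agree, since their common endpoint cannot be both flat and not flat. *)
pose P s t := (forall x, s <= x <= t -> flat x) \/
  ((forall x, s <= x <= t -> ~ flat x) /\ finite_set [set x | s <= x <= t /\ f x = 0]).
suff [fl|[_ fin]] : P a b; [left|by right|].
  by move=> x /fl[r r0]; apply; rewrite subrr normr0.
apply: interval_additive_property => // [s t u st tu|x /floc[[r r0 f0]|[r r0 fN0]]].
- case=> [fl1|[nf1 fin1]]; case=> [fl2|[nf2 fin2]].
  + left=> x /andP[sx xu]; have [xt|/ltW tx] := leP x t.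
      by apply: fl1; rewrite sx.
    by apply: fl2; rewrite tx.
  + by case: (nf2 t); rewrite ?lexx //; apply: fl1; rewrite lexx st.
  + by case: (nf1 t); rewrite ?lexx ?st //; apply: fl2; rewrite lexx tu.
  + right; split=> [x /andP[sx xu]|].
      have [xt|/ltW tx] := leP x t; first by apply: nf1; rewrite sx.
      by apply: nf2; rewrite tx.
    have : finite_set ([set x | s <= x <= t /\ f x = 0] `|`
                       [set x | t <= x <= u /\ f x = 0]) by rewrite finite_setU.
    apply: sub_finite_set => x [/andP[sx xu] fx].
    by have [xt|/ltW tx] := leP x t; [left; rewrite /= sx|right; rewrite /= tx].
- exists r => // s t _ xs tx; left => y /andP[sy yt].
  exists (r - `|y - x|); first by rewrite subr_gt0 ltr_norml; apply/andP; split; lra.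
  move=> z zy; apply: f0; rewrite (_ : z - x = (z - y) + (y - x)); last by ring.
  by rewrite (le_lt_trans (ler_normD _ _)) // -ltrBrDr.
- exists r => // s t _ xs tx; right; split=> [y /andP[sy yt] [e e0 fe]|].
    (* If [y] were flat, [y] and [y + d] would both be zeros of [f] in the neighbourhood where only
       [x] can be one; both would equal [x]. *)
    pose d := Num.min e (r - `|y - x|) / 2.
    have yx : `|y - x| < r by rewrite ltr_norml; apply/andP; split; lra.
    have m0 : 0 < Num.min e (r - `|y - x|) by rewrite lt_min e0 subr_gt0.
    have d0 : 0 < d by rewrite divr_gt0.
    have dm : d < Num.min e (r - `|y - x|) by rewrite /d; lra.
    move: dm; rewrite lt_min => /andP[de dr].
    have key z : `|z - y| <= d -> z = x.
      move=> zy; apply/eqP/negPn/negP => zx.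
      have := fN0 z _ zx; rewrite fe ?(le_lt_trans zy) // => /(_ _)/eqP; apply=> //.
      rewrite (_ : z - x = (z - y) + (y - x)); last by ring.
      by rewrite (le_lt_trans (ler_normD _ _)) // -ltrBrDr (le_lt_trans zy).
    have : y = x by apply: key; rewrite subrr normr0 ltW.
    have : y + d = x by apply: key; rewrite addrC addKr gtr0_norm.
    lra.
  apply: (sub_finite_set _ (finite_set1 x)) => y [/andP[sy yt] fy] /=.
  apply/eqP/negPn/negP => /fN0; rewrite fy eqxx => /(_ _)/notF; apply.
  by rewrite ltr_norml; apply/andP; split; lra.
Qed.

End IntervalDichotomy.

(** * Complex-valued analytic functions of a real variable *)

Section ComplexTaylor.
Variable R : realType.

(** The point comes first so that [ctaylor_at x0] is a predicate suited to [function_subring]. *)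
Definition ctaylor_at (x0 : R) (g : R -> R[i]) :=
  taylor_at (fun x => complex.Re (g x)) x0 /\ taylor_at (fun x => complex.Im (g x)) x0.

Lemma ctaylor_at_subring (x0 : R) : function_subring (ctaylor_at x0).
Proof.
split=> [c|f g [fR fI] [gR gI]|f g [fR fI] [gR gI]].
- by split; exact: taylor_at_cst.
- have E x : f x + g x = ((complex.Re (f x) + complex.Re (g x)) +i*
      (complex.Im (f x) + complex.Im (g x)))%C by case: (f x) => ? ?; case: (g x).
  by split; under eq_fun do rewrite E; exact: taylor_at_add.
- have E x : f x * g x =
      ((complex.Re (f x) * complex.Re (g x) + -1 * (complex.Im (f x) * complex.Im (g x))) +i*
       (complex.Re (f x) * complex.Im (g x) + complex.Im (f x) * complex.Re (g x)))%C.
    by rewrite mulN1r; case: (f x) => ? ?; case: (g x).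
  split; under eq_fun do rewrite E /=; apply: taylor_at_add; try exact: taylor_at_mul.
  by apply: taylor_at_mul; [exact: taylor_at_cst|exact: taylor_at_mul].
Qed.

(** The variable being real, conjugation merely negates the imaginary part's series. *)
Lemma ctaylor_at_conj (x0 : R) (g : R -> R[i]) :
  ctaylor_at x0 g -> ctaylor_at x0 (fun x => Num.conj (g x)).
Proof.
case=> gR gI; have E x : Num.conj (g x) = (complex.Re (g x) +i* (-1 * complex.Im (g x)))%C.
  by rewrite mulN1r; case: (g x).
split; under eq_fun do rewrite E /=; first by [].
by apply: taylor_at_mul => //; exact: taylor_at_cst.
Qed.

Lemma power_series_ctaylor_at (x0 : R) (g : R -> R[i]) :
  power_series_at g x0 -> ctaylor_at x0 g.
Proof.
case=> c [r [r0 H]]; split.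
  exact: (@cvg_power_series_taylor_at _ (fun x => complex.Re (g x))
    (fun k => complex.Re (c k)) _ _ r0 (fun y yr => (H y yr).1)).
exact: (@cvg_power_series_taylor_at _ (fun x => complex.Im (g x))
    (fun k => complex.Im (c k)) _ _ r0 (fun y yr => (H y yr).2)).
Qed.

End ComplexTaylor.

(** * The dichotomy for repeated singular values *)

Theorem theorem4p5 (R : realType) (m n : nat) (a b : R)
  (F : R -> 'M[R[i]]_(m, n)) :
  (n <= m)%N -> a < b ->
  (forall (i : 'I_m) (j : 'I_n), analytic_on_closed a b (fun x => F x i j)) ->
  let W := [set x : R | a <= x <= b /\ repeated_singular_values (F x)] in
  W = `[a, b]%classic \/ finite_set W.
Proof.
move=> _ ab; case: n F => [|n] F Fan W.
  (* For [n = 0] the characteristic polynomial is [1], which has no root. *)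
  right; rewrite (_ : W = set0) ?finite_set0 // -subset0 => x [_].
  case/repeated_singular_valuesP => z.
  rewrite /char_poly det_mx00 mup_gt1_deriv ?oner_neq0 //.
  by rewrite /root hornerC oner_eq0.
(* Passing to the extensions gives two-sided neighbourhoods also at the endpoints [a] and [b]. *)
have extend i j : exists g : R -> R[i], forall x, a <= x <= b ->
    g x = F x i j /\ ctaylor_at x g.
  have [g [c [d [ca [bd [gF gps]]]]]] := Fan i j.
  exists g => x /andP[ax xb]; split; first by rewrite gF // ax.
  by apply/power_series_ctaylor_at/gps; rewrite (lt_le_trans ca) // (le_lt_trans xb).
pose g i j := projT1 (cid (extend i j)).
have gP i j : forall x, a <= x <= b -> g i j x = F x i j /\ ctaylor_at x (g i j).
  exact: projT2 (cid (extend i j)).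
pose G x : 'M[R[i]]_(m, n.+1) := \matrix_(i, j) g i j x.
have GF x : a <= x <= b -> G x = F x.
  by move=> xab; apply/matrixP => i j; rewrite mxE (gP i j x xab).1.
pose H x := adjoint (G x) *m G x.
pose D x := \det (horner_mx (H x) (char_poly (H x))^`()).
pose f x := complex.Re (D x) * complex.Re (D x) + complex.Im (D x) * complex.Im (D x).
have DP x : f x = 0 <-> D x = 0.
  rewrite /f; split=> [/eqP|->]; last by rewrite !mulr0 addr0.
  rewrite -!expr2 paddr_eq0 ?sqr_ge0 // !sqrf_eq0 => /andP[/eqP re0 /eqP im0].
  by rewrite [LHS]complexE re0 im0 mulr0 addr0.
have WE : W = [set x | a <= x <= b /\ f x = 0].
  apply/seteqP; split=> x [xab rep]; split=> //.
    by apply/DP/mup_char_poly_gt1/repeated_singular_valuesP; rewrite GF.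
  by rewrite -GF //; apply/repeated_singular_valuesP/mup_char_poly_gt1/DP.
have Dan x : a <= x <= b -> ctaylor_at x D.
  move=> xab; have sub := ctaylor_at_subring x.
  have [Pc PD PM] := sub.
  have Gan i j : ctaylor_at x (fun y => G y i j).
    by under eq_fun do rewrite mxE; exact: (gP i j x xab).2.
  have Han i j : ctaylor_at x (fun y => H y i j).
    apply: (function_subring_mulmx sub) => // {}i {}j.
    by under eq_fun do rewrite !mxE; apply: ctaylor_at_conj;
      have := Gan j i; under eq_fun do rewrite mxE.
  apply: (function_subring_det sub) => i j.
  (* The matrix has dimension [n.+1], so [char_poly] has size [n.+2] and its derivative size at most
     [n.+1]. *)
  apply: (function_subring_horner_mx sub (d := n.+1)) => // [y|k].
    by rewrite (leq_trans (size_poly _ _)) // size_char_poly.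
  under eq_fun do rewrite coef_deriv -mulr_natr.
  by apply: PM; [exact: (function_subring_char_poly sub)|exact: Pc].
have [f0|] : (forall x, a <= x <= b -> f x = 0) \/
    finite_set [set x | a <= x <= b /\ f x = 0].
- apply: zeros_all_or_finite => [|x xab]; first exact: ltW.
  have [DR DI] := Dan x xab.
  by apply/taylor_at_isolated_zero/taylor_at_add; exact: taylor_at_mul.
- left; rewrite WE; apply/seteqP; split=> x /=; rewrite in_itv /=; first by case.
  by move=> xab; split=> //; exact: f0.
- by rewrite -WE; right.
Qed.
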